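(* Let $n,m\ge1$, $a\in\mathbb{R}^n$ with $\|a\|=1$, $d\in\mathbb{R}^m$ with $\|d\|<1$, and $\lambda\in\mathbb{R}^n$ with $\|\lambda\|=1$ and $\lambda\neq\pm a$. Let $$H=\{(x,y)\in\mathbb{R}^{n+m} : a^\mathsf{T} x+d^\mathsf{T} y=-1\},\qquad S_{\le0}=\{(x,y)\in\mathbb{R}^{n+m}:\|x\|\le\|y\|,\ a^\mathsf{T} x+d^\mathsf{T} y\le 0\},$$ and $$C=\{(x,y)\in\mathbb{R}^{n+m} : -\lambda^\mathsf{T} x+\nabla\phi_\lambda(\beta)^\mathsf{T} y\le r(\beta)\ \text{ for all }\beta\in\mathbb{R}^m,\ \|\beta\|=1\}.$$ Then $C$ is maximal $S_{\le0}$-free with respect to $H$. Additionally, if $\lambda=\bar x/\|\bar x\|$ for some $(\bar x,\bar y)\in H$ with $\|\bar x\|>\|\bar y\|$, then $(\bar x,\bar y)\in\operatorname{int}(C)$.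
   Context: $\|\cdot\|$ is the Euclidean norm. For $y\in\mathbb{R}^m$, $\phi_\lambda(y)=\max\{\lambda^\mathsf{T} x : x\in\mathbb{R}^n,\ \|x\|\le\|y\|,\ a^\mathsf{T} x+d^\mathsf{T} y\le 0\}$; under the hypotheses this is a finite convex function differentiable on $\mathbb{R}^m\setminus\{0\}$, and $\nabla\phi_\lambda(\beta)$ denotes its gradient. For $\|\beta\|=1$, $r(\beta)=0$ if $\lambda^\mathsf{T} a+d^\mathsf{T}\beta\le0$, and otherwise $r(\beta)=\dfrac{d^\mathsf{T}\beta+\lambda^\mathsf{T} a\,\phi_\lambda(\beta)}{\phi_\lambda(\beta)+d^\mathsf{T}\beta\,\lambda^\mathsf{T} a}$. For a closed set $S$, a convex set $C$ is $S$-free if $\operatorname{int}(C)\cap S=\emptyset$. Given an affine hyperplane $H$, a closed convex $C$ is $S$-free with respect to $H$ if the interior of $C\cap H$ relative to $H$ does not meet $S\cap H$; it is maximal $S$-free with respect to $H$ if for every closed convex $C'\supseteq C$ that is $S$-free with respect to $H$, $C'\cap H\subseteq C\cap H$. *)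

(* Defs.v *)
From mathcomp Require Import all_boot all_order all_algebra.
From mathcomp Require Import classical_sets reals.
Set Implicit Arguments. Unset Strict Implicit. Unset Printing Implicit Defensive.
Import Order.TTheory GRing.Theory Num.Theory.
Local Open Scope ring_scope.
Local Open Scope classical_set_scope.

Section Defs.
Variable R : realType.

Definition dotv {k} (u v : 'rV[R]_k) : R := \sum_(i < k) u 0 i * v 0 i.
Definition enorm {k} (u : 'rV[R]_k) : R := Num.sqrt (dotv u u).

Definition is_gradient {k} (f : 'rV[R]_k -> R) (x g : 'rV[R]_k) : Prop :=
  forall eps : R, 0 < eps -> exists2 delta : R, 0 < delta &
    forall h : 'rV[R]_k, enorm h < delta ->
      `| f (x + h) - f x - dotv g h | <= eps * enorm h.

Variables (n m : nat).
Notation pt := ('rV[R]_n * 'rV[R]_m)%type.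

Definition pdist (p q : pt) : R :=
  Num.sqrt (dotv (p.1 - q.1) (p.1 - q.1) + dotv (p.2 - q.2) (p.2 - q.2)).

Definition phi (a lam : 'rV[R]_n) (d : 'rV[R]_m) (y : 'rV[R]_m) : R :=
  sup [set dotv lam x | x in [set x : 'rV[R]_n |
         enorm x <= enorm y /\ dotv a x + dotv d y <= 0]].

Definition rfun (a lam : 'rV[R]_n) (d : 'rV[R]_m) (beta : 'rV[R]_m) : R :=
  if dotv lam a + dotv d beta <= 0 then 0
  else (dotv d beta + dotv lam a * phi a lam d beta) /
       (phi a lam d beta + dotv d beta * dotv lam a).

Definition Hplane (a : 'rV[R]_n) (d : 'rV[R]_m) : set pt :=
  [set p | dotv a p.1 + dotv d p.2 = -1].

Definition Sle0 (a : 'rV[R]_n) (d : 'rV[R]_m) : set pt :=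
  [set p | enorm p.1 <= enorm p.2 /\ dotv a p.1 + dotv d p.2 <= 0].

Definition Cset (a lam : 'rV[R]_n) (d : 'rV[R]_m) : set pt :=
  [set p | forall beta g : 'rV[R]_m, enorm beta = 1 ->
      is_gradient (phi a lam d) beta g ->
      - dotv lam p.1 + dotv g p.2 <= rfun a lam d beta].

Definition closed_set (C : set pt) : Prop :=
  forall p, (forall eps : R, 0 < eps -> exists2 q, C q & pdist p q < eps) -> C p.

Definition convex_set (C : set pt) : Prop :=
  forall p q (t : R), C p -> C q -> 0 <= t <= 1 ->
    C (t *: p.1 + (1 - t) *: q.1, t *: p.2 + (1 - t) *: q.2).

Definition interior_pt (C : set pt) : set pt :=
  [set p | exists2 eps : R, 0 < eps & forall q, pdist p q < eps -> C q].

Definition relint_in (H C : set pt) : set pt :=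
  [set p | H p /\ C p /\
     exists2 eps : R, 0 < eps & forall q, H q -> pdist p q < eps -> C q].

Definition S_free_wrt (S H C : set pt) : Prop :=
  forall p, relint_in H C p -> (S `&` H) p -> False.

Definition maximal_S_free_wrt (S H C : set pt) : Prop :=
  closed_set C /\ convex_set C /\ S_free_wrt S H C /\
  forall C' : set pt, closed_set C' -> convex_set C' -> C `<=` C' ->
    S_free_wrt S H C' -> C' `&` H `<=` C `&` H.

End Defs.

(* Main.v *)
(* For a unit vector [b], let [optx b] maximize [lam.x] subject to [|x| <= 1]
   and [a.x + d.b <= 0].  Stationarity reads [lam = c (optx b) + h a] with
   [c > 0] and [h >= 0]; weak duality then shows that the gradient of [phi] at
   [b] is [c b - h d], and one computes [rfun b = h].  Consequently, on the
   hyperplane the inequality of [Cset] indexed by [b] becomes the homogeneous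
   inequality [b.y <= (optx b).x].

   Freeness: at a point of [Sle0] with [y = |y| b] this inequality is tight, and
   it fails after an arbitrarily small move in the hyperplane.

   Maximality: since [b.b' <= (optx b).(optx b')], the vector [(optx b, b)] is,
   up to scaling, a point or a recession direction of [Cset] in the hyperplane,
   and it satisfies [|x| = |y|].  If a point violates the inequality indexed by
   [b], combining it with that vector yields [|x| < |y|], and mixing in a Slater
   point of [Cset] produces a relative interior point inside [Sle0]. *)
Require Import Defs.
From mathcomp Require Import all_boot all_order all_algebra.
From mathcomp Require Import classical_sets reals.
From mathcomp Require Import ring lra.
Import Order.TTheory GRing.Theory Num.Theory.
Local Open Scope ring_scope.

(** * Inner product, Cauchy-Schwarz inequalities and uniqueness of gradients *)

Section InnerProduct.
Context {R : realType} {k : nat}.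
Implicit Types (u v w : 'rV[R]_k) (t : R).

Lemma dotvC u v : dotv u v = dotv v u.
Proof. by apply: eq_bigr => i _; rewrite mulrC. Qed.

Lemma dotvDr u v w : dotv u (v + w) = dotv u v + dotv u w.
Proof. by rewrite -big_split; apply: eq_bigr => i _; rewrite mxE mulrDr. Qed.

Lemma dotvZr t u v : dotv u (t *: v) = t * dotv u v.
Proof. by rewrite mulr_sumr; apply: eq_bigr => i _; rewrite mxE; ring. Qed.

Lemma dotvNr u v : dotv u (- v) = - dotv u v.
Proof. by rewrite -scaleN1r dotvZr mulN1r. Qed.

Lemma dotv0r u : dotv u 0 = 0.
Proof. by rewrite -(scale0r 0) dotvZr mul0r. Qed.

Lemma dotvDl u v w : dotv (v + w) u = dotv v u + dotv w u.
Proof. by rewrite !(dotvC _ u) dotvDr. Qed.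

Lemma dotvZl t u v : dotv (t *: v) u = t * dotv v u.
Proof. by rewrite !(dotvC _ u) dotvZr. Qed.

Lemma dotvNl u v : dotv (- v) u = - dotv v u.
Proof. by rewrite !(dotvC _ u) dotvNr. Qed.

Lemma dotv0l u : dotv 0 u = 0.
Proof. by rewrite dotvC dotv0r. Qed.

Definition dotvE :=
  (dotvDr, dotvDl, dotvNr, dotvNl, dotvZr, dotvZl, dotv0r, dotv0l).

Lemma dotvv_ge0 u : 0 <= dotv u u.
Proof. by apply: sumr_ge0 => i _; rewrite -expr2 sqr_ge0. Qed.

Lemma dotvv_eq0 u : dotv u u = 0 -> u = 0.
Proof.
move=> u0; apply/rowP => i; rewrite mxE.
have /eqP := psumr_eq0P (fun i _ => sqr_ge0 (u 0 i)) u0 (erefl true) (i := i).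
by rewrite sqrf_eq0 => /eqP.
Qed.

Lemma enorm_ge0 u : 0 <= enorm u.
Proof. exact: sqrtr_ge0. Qed.

Lemma dotvv u : dotv u u = enorm u ^+ 2.
Proof. by rewrite sqr_sqrtr // dotvv_ge0. Qed.

Lemma enorm_eq0 u : enorm u = 0 -> u = 0.
Proof. by move=> u0; apply: dotvv_eq0; rewrite dotvv u0 expr0n. Qed.

Lemma enorm_gt0 u : u <> 0 -> 0 < enorm u.
Proof.
move=> u0; rewrite lt0r enorm_ge0 andbT.
by apply/eqP => /enorm_eq0.
Qed.

Lemma enorm_eq u t : 0 <= t -> dotv u u = t ^+ 2 -> enorm u = t.
Proof. by move=> t0 uE; rewrite /enorm uE sqrtr_sqr ger0_norm. Qed.

Lemma enorm_le u t : 0 <= t -> dotv u u <= t ^+ 2 -> enorm u <= t.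
Proof. by move=> t0; rewrite dotvv ler_sqr ?nnegrE ?enorm_ge0. Qed.

Lemma enorm0 : enorm (0 : 'rV[R]_k) = 0.
Proof. by apply: enorm_eq; rewrite ?dotv0r ?expr0n. Qed.

Lemma enormZ t u : 0 <= t -> enorm (t *: u) = t * enorm u.
Proof.
move=> t0; apply: enorm_eq; first by rewrite mulr_ge0 ?enorm_ge0.
by rewrite !dotvE dotvv; ring.
Qed.

Lemma dotv_le u v : dotv u v <= enorm u * enorm v.
Proof.
have [/enorm_eq0 ->|u0] := eqVneq (enorm u) 0.
  by rewrite dotv0l enorm0 mul0r.
have [/enorm_eq0 ->|v0] := eqVneq (enorm v) 0.
  by rewrite dotv0r enorm0 mulr0.
have up : 0 < enorm u by rewrite lt0r u0 enorm_ge0.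
have vp : 0 < enorm v by rewrite lt0r v0 enorm_ge0.
have := dotvv_ge0 (enorm v *: u - enorm u *: v).
rewrite !dotvE (dotvC v u) !dotvv => h.
suff: 0 <= (enorm u * enorm v) * (enorm u * enorm v - dotv u v).
  by rewrite pmulr_rge0 ?mulr_gt0 // subr_ge0.
lra.
Qed.

Lemma dotv_ge u v : - (enorm u * enorm v) <= dotv u v.
Proof.
have := dotv_le (- u) v; rewrite dotvNl.
have -> : enorm (- u) = enorm u.
  by apply: enorm_eq; rewrite ?enorm_ge0 // !dotvE dotvv; ring.
lra.
Qed.

Lemma dotv_unit_le u v : dotv u u = 1 -> dotv u v <= enorm v.
Proof.
move=> u1; have := dotv_le u v.
by rewrite (@enorm_eq u 1) ?mul1r // u1 expr1n.
Qed.

(* The Cauchy-Schwarz inequality for the form [u.v - (d.u)(d.v)]. *)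
Lemma dotv_pair_le d u v (p q : R) : enorm d < 1 -> 0 < p -> 0 < q ->
  p ^+ 2 = dotv u u - dotv d u ^+ 2 -> q ^+ 2 = dotv v v - dotv d v ^+ 2 ->
  dotv u v <= p * q + dotv d u * dotv d v.
Proof.
move=> d1 p0 q0 pE qE.
have psd x : 0 <= dotv x x - dotv d x ^+ 2.
  rewrite subr_ge0 dotvv -real_normK ?num_real // ler_sqr ?nnegrE ?enorm_ge0 //.
  have le1 : enorm d * enorm x <= enorm x.
    by rewrite ler_piMl ?enorm_ge0 // ltW.
  rewrite ler_norml; apply/andP; split.
    by apply: le_trans (dotv_ge d x); rewrite lerN2.
  exact: le_trans (dotv_le d x) le1.
(* The positive semidefinite form at this vector equals [2 p q (p q + (d.u)(d.v) - u.v)]. *)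
have := psd (q *: u - p *: v); rewrite !dotvE (dotvC v u) => h.
suff: 0 <= (p * q) * (p * q + dotv d u * dotv d v - dotv u v).
  by rewrite pmulr_rge0 ?mulr_gt0 // subr_ge0.
have uE : dotv u u = p ^+ 2 + dotv d u ^+ 2 by lra.
have vE : dotv v v = q ^+ 2 + dotv d v ^+ 2 by lra.
move: h; rewrite uE vE.
lra.
Qed.

Lemma is_gradient_uniq f x g g' : is_gradient f x g -> is_gradient f x g' ->
  g = g' :> 'rV[R]_k.
Proof.
move=> gf gf'; apply/eqP; rewrite -subr_eq0; apply/eqP/enorm_eq0.
set e := enorm (g - g').
have e0 : 0 <= e := enorm_ge0 _.
apply/eqP/negPn/negP => en0; have {}e0 : 0 < e by rewrite lt0r en0.
(* Along [t (g - g')] the two linear parts differ by [t e^2], while two errors of slope [e / 4]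
   allow only [t e^2 / 2]. *)
have e4 : 0 < e / 4 by rewrite divr_gt0.
have [r r0 hr] := gf _ e4; have [r' r'0 hr'] := gf' _ e4.
pose t := (Num.min r r') / (2 * e).
have m0 : 0 < Num.min r r' by rewrite lt_min r0.
have t0 : 0 < t by rewrite divr_gt0 // mulr_gt0.
have tE : t * e = Num.min r r' / 2 by rewrite /t; field; rewrite gt_eqF.
have hE : enorm (t *: (g - g')) = t * e by rewrite enormZ // ltW.
have lt_m : t * e < Num.min r r' by rewrite tE; lra.
have lt_r : t * e < r by rewrite (lt_le_trans lt_m) // ge_min lexx.
have lt_r' : t * e < r' by rewrite (lt_le_trans lt_m) // ge_min lexx orbT.
have := hr (t *: (g - g')); rewrite hE => /(_ lt_r).
have := hr' (t *: (g - g')); rewrite hE => /(_ lt_r').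
have : dotv g (t *: (g - g')) - dotv g' (t *: (g - g')) = t * e ^+ 2.
  by rewrite -dotvv !dotvE; ring.
rewrite !ler_norml => h /andP[_ h1] /andP[h2 _].
have : 0 < t * e ^+ 2 by rewrite mulr_gt0 // exprn_gt0.
lra.
Qed.

End InnerProduct.

(** * Distance on pairs and the quadratic form [|y|^2 - |x|^2] *)

Section Distance.
Context {R : realType} {n m : nat}.
Implicit Types (p q c : 'rV[R]_n * 'rV[R]_m) (t : R).

Lemma enorm_fst_pdist p q : enorm (p.1 - q.1) <= pdist p q.
Proof. by rewrite ler_sqrt ?addr_ge0 ?dotvv_ge0 // lerDl dotvv_ge0. Qed.

Lemma enorm_snd_pdist p q : enorm (p.2 - q.2) <= pdist p q.
Proof. by rewrite ler_sqrt ?addr_ge0 ?dotvv_ge0 // lerDr dotvv_ge0. Qed.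

Lemma dotv_fst_pdist u p q : enorm u <= 1 ->
  `|dotv u p.1 - dotv u q.1| <= pdist p q.
Proof.
move=> u1; have le_p : enorm u * enorm (p.1 - q.1) <= pdist p q.
  by apply: le_trans (enorm_fst_pdist p q); rewrite ler_piMl ?enorm_ge0.
have := dotv_le u (p.1 - q.1); have := dotv_ge u (p.1 - q.1).
by rewrite dotvDr dotvNr ler_norml => h1 h2; apply/andP; split; lra.
Qed.

Lemma dotv_snd_pdist u p q : enorm u <= 1 ->
  `|dotv u p.2 - dotv u q.2| <= pdist p q.
Proof.
move=> u1; have le_p : enorm u * enorm (p.2 - q.2) <= pdist p q.
  by apply: le_trans (enorm_snd_pdist p q); rewrite ler_piMl ?enorm_ge0.
have := dotv_le u (p.2 - q.2); have := dotv_ge u (p.2 - q.2).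
by rewrite dotvDr dotvNr ler_norml => h1 h2; apply/andP; split; lra.
Qed.

Lemma pdist_homothety t p q p' q' : 0 <= t ->
  p'.1 - q'.1 = t *: (p.1 - q.1) -> p'.2 - q'.2 = t *: (p.2 - q.2) ->
  pdist p' q' = t * pdist p q.
Proof.
move=> t0 e1 e2; rewrite /pdist e1 e2 !dotvZl !dotvZr !mulrA -mulrDr -expr2.
by rewrite sqrtrM ?sqr_ge0 // sqrtr_sqr ger0_norm.
Qed.

(** Squared norms make the comparison of [|x|] and [|y|] polynomial along segments, so signs for
    small weights can be read from the leading term. *)
Definition normgap p : R := dotv p.2 p.2 - dotv p.1 p.1.

Lemma normgap_ge0 p : 0 <= normgap p -> enorm p.1 <= enorm p.2.
Proof.
by move=> h; apply: enorm_le; rewrite ?enorm_ge0 // -dotvv -subr_ge0.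
Qed.

(** [(u, v)] is a null vector of the form, so no term in [t^2] appears and the gap is affine in
    [t]. *)
Lemma normgap_translate p t u v : dotv u u = dotv v v ->
  normgap (p.1 + t *: u, p.2 + t *: v) =
  normgap p + 2 * (t * (dotv v p.2 - dotv u p.1)).
Proof.
move=> uv; rewrite /normgap /= !dotvE uv (dotvC p.1 u) (dotvC p.2 v); ring.
Qed.

Lemma normgap_mix_null p s t u v : dotv u u = dotv v v ->
  normgap (t *: p.1 + (1 - t) *: (s *: u), t *: p.2 + (1 - t) *: (s *: v)) =
  t * ((1 - t) * (2 * (s * (dotv v p.2 - dotv u p.1))) + t * normgap p).
Proof.
move=> uv; rewrite /normgap /= !dotvE uv (dotvC p.1 u) (dotvC p.2 v); ring.
Qed.

Lemma linear_gt0_near0 (A B : R) : 0 < A ->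
  exists2 t, 0 < t < 1 & 0 < (1 - t) * A + t * B.
Proof.
move=> A0; have B0 := normr_ge0 B.
have s0 : 0 < 2 * (A + `|B|) by lra.
(* With [t = A / (2 (A + |B|))] the expression is at least [A - t (A + |B|) = A / 2]. *)
have := mulfVK (lt0r_neq0 s0) A; set t := A / _ => tE.
have t0 : 0 < t by rewrite divr_gt0.
have t1 : t < 1 by rewrite ltr_pdivrMr // mul1r; lra.
exists t; first by rewrite t0.
have : t * - `|B| <= t * B by rewrite ler_pM2l // lerNnormlW.
lra.
Qed.

Lemma quadratic_ge0_near0 (A B D : R) : 0 < A ->
  exists2 t, 0 < t < 1 &
    0 <= (1 - t) ^+ 2 * A + 2 * t * (1 - t) * B + t ^+ 2 * D.
Proof.
(* This slope makes [A - 2tA - 2t|B| - t|D|] positive, and that is a lower bound for the quadratic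
   on (0, 1). *)
move=> A0; have [t /andP[t0 t1] tE] :=
  linear_gt0_near0 A (- (A + 2 * `|B| + `|D|)) A0.
have u0 : 0 < 1 - t by rewrite subr_gt0.
exists t; first by rewrite t0.
have hA : 0 < t * (t * A) by rewrite !mulr_gt0.
have hB : t * (1 - t) * - `|B| <= t * (1 - t) * B.
  by rewrite ler_wpM2l ?lerNnormlW // mulr_ge0 // ltW.
have hB' : 0 <= t * (t * `|B|) by rewrite !mulr_ge0 // ltW.
have hD : t ^+ 2 * - `|D| <= t ^+ 2 * D.
  by rewrite ler_wpM2l ?sqr_ge0 ?lerNnormlW.
have hD' : 0 <= t * (1 - t) * `|D| by rewrite !mulr_ge0 // ltW.
lra.
Qed.

Lemma normgap_mix p c : 0 < normgap p -> exists2 t, 0 < t < 1 &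
  0 <= normgap (t *: c.1 + (1 - t) *: p.1, t *: c.2 + (1 - t) *: p.2).
Proof.
move=> p0; have [t t01 tE] := quadratic_ge0_near0 (normgap p)
  (dotv c.2 p.2 - dotv c.1 p.1) (normgap c) p0.
exists t => //; move: tE; rewrite /normgap /= !dotvE.
rewrite (dotvC p.1 c.1) (dotvC p.2 c.2) => h.
lra.
Qed.

End Distance.

(** * Lagrange multipliers and maximizers for unit vectors *)

Section Multipliers.
Local Open Scope classical_set_scope.
Context {R : realType} {n m : nat}.
Variables (a lam : 'rV[R]_n) (d : 'rV[R]_m).
Hypotheses (ha : enorm a = 1) (hd : enorm d < 1) (hlam : enorm lam = 1).
Hypotheses (hla : lam <> a) (hlma : lam <> - a).
Implicit Types (b y : 'rV[R]_m) (x : 'rV[R]_n).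

(* Lagrange multipliers of the problem defining [phi] at a unit vector [b]:
   [optx] is the maximizer, with [lam = nmul *: optx + hmul *: a], where
   [hmul] is the multiplier of [a.x + d.b <= 0]. *)
Definition slk b : R := Num.sqrt (1 - dotv d b ^+ 2).
Definition sgm : R := Num.sqrt (1 - dotv lam a ^+ 2).
Definition hmul b : R :=
  if dotv lam a + dotv d b <= 0 then 0
  else dotv lam a + sgm * dotv d b / slk b.
Definition nmul b : R :=
  if dotv lam a + dotv d b <= 0 then 1 else sgm / slk b.
Definition optx b : 'rV[R]_n := (nmul b)^-1 *: (lam - hmul b *: a).
Definition gradv b : 'rV[R]_m := nmul b *: b - hmul b *: d.

Let aa : dotv a a = 1. Proof. by rewrite dotvv ha expr1n. Qed.
Let ll : dotv lam lam = 1. Proof. by rewrite dotvv hlam expr1n. Qed.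
Let dotv_unit b : enorm b = 1 -> dotv b b = 1.
Proof. by rewrite dotvv => ->; rewrite expr1n. Qed.

Lemma lam_a_bound : -1 < dotv lam a < 1.
Proof.
have p1 : 0 < dotv (lam - a) (lam - a).
  rewrite lt0r dotvv_ge0 andbT; apply/eqP => /dotvv_eq0 /eqP.
  by rewrite subr_eq0 => /eqP.
have p2 : 0 < dotv (lam + a) (lam + a).
  rewrite lt0r dotvv_ge0 andbT; apply/eqP => /dotvv_eq0 /eqP.
  by rewrite addr_eq0 => /eqP.
move: p1 p2; rewrite !dotvE (dotvC a lam) aa ll => p1 p2.
by apply/andP; split; lra.
Qed.

Lemma lam_a_sqr : 0 < 1 - dotv lam a ^+ 2.
Proof.
have /andP[h1 h2] := lam_a_bound.
have -> : 1 - dotv lam a ^+ 2 = (1 - dotv lam a) * (1 + dotv lam a) by ring.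
by apply: mulr_gt0; lra.
Qed.

Lemma sgm_gt0 : 0 < sgm.
Proof. by rewrite sqrtr_gt0 lam_a_sqr. Qed.

Lemma sgm_sqr : sgm ^+ 2 = 1 - dotv lam a ^+ 2.
Proof. by rewrite sqr_sqrtr // ltW // lam_a_sqr. Qed.

Lemma dotv_d_sqr b : enorm b = 1 -> dotv d b ^+ 2 <= enorm d ^+ 2.
Proof.
move=> b1; have := dotv_le d b; have := dotv_ge d b.
rewrite b1 mulr1 => h1 h2.
by rewrite -(real_normK (num_real (dotv d b))) ler_sqr ?nnegrE ?enorm_ge0 //
  ler_norml h1.
Qed.

Lemma enorm_d_sqr : 0 < 1 - enorm d ^+ 2.
Proof. by rewrite subr_gt0 expr_lt1 ?enorm_ge0. Qed.

Lemma slk_gt0 b : enorm b = 1 -> 0 < slk b.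
Proof.
move=> b1; rewrite sqrtr_gt0; have := dotv_d_sqr b b1.
have := enorm_d_sqr; lra.
Qed.

Lemma slk_sqr b : enorm b = 1 -> slk b ^+ 2 = 1 - dotv d b ^+ 2.
Proof.
move=> b1; rewrite sqr_sqrtr //; have := dotv_d_sqr b b1.
have := enorm_d_sqr; lra.
Qed.

Lemma nmul_gt0 b : enorm b = 1 -> 0 < nmul b.
Proof.
move=> b1; rewrite /nmul; case: ifP => // _.
by rewrite divr_gt0 ?sgm_gt0 ?slk_gt0.
Qed.

(** When [lam.a + d.b > 0], write [lam.a] = sin A and [d.b] = sin B with A, B in (-pi/2, pi/2). Then
    [hmul b * slk b] is sin (A + B), positive because sin A + sin B is. The sign cases below prove
    this algebraically. *)
Lemma hmul_ge0 b : enorm b = 1 -> 0 <= hmul b.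
Proof.
move=> b1; rewrite /hmul; case: ifPn => //; rewrite -ltNge => h.
have w0 := slk_gt0 b b1; have wE := slk_sqr b b1.
have s0 := sgm_gt0; have sE := sgm_sqr.
rewrite -(pmulr_lge0 _ w0) mulrDl mulfVK ?gt_eqF //.
move: (slk b) (dotv d b) (dotv lam a) h w0 wE sE => w s t h w0 wE sE.
have [t0|t0] := lerP 0 t; have [s1|s1] := lerP 0 s.
- by apply: addr_ge0; apply: mulr_ge0 => //; apply: ltW.
- have : sgm ^+ 2 <= w ^+ 2 by nra.
  rewrite ler_sqr ?nnegrE; [move=> le_w | exact: ltW | exact: ltW].
  have : sgm * - s <= w * t by apply: ler_pM; lra.
  lra.
- have : w ^+ 2 <= sgm ^+ 2 by nra.
  rewrite ler_sqr ?nnegrE; [move=> le_w | exact: ltW | exact: ltW].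
  have : w * - t <= sgm * s by apply: ler_pM; lra.
  lra.
- lra.
Qed.

Lemma lam_decomp b : enorm b = 1 -> lam = nmul b *: optx b + hmul b *: a.
Proof.
move=> b1; rewrite scalerA mulfV ?scale1r ?gt_eqF ?nmul_gt0 //.
by rewrite subrK.
Qed.

Lemma dotv_lam_decomp b x : enorm b = 1 ->
  dotv lam x = nmul b * dotv (optx b) x + hmul b * dotv a x.
Proof.
move=> b1; rewrite {1}(lam_decomp b b1) dotvDl.
by rewrite (dotvZl (nmul b) x (optx b)) (dotvZl (hmul b) x a).
Qed.

(** The right-hand side is [|lam - hmul b *: a|^2], so [nmul b] is the factor that normalizes
    [optx b]. *)
Lemma nmul_sqr b : enorm b = 1 ->
  nmul b ^+ 2 = 1 - 2 * hmul b * dotv lam a + hmul b ^+ 2.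
Proof.
move=> b1; rewrite /nmul /hmul; case: ifP => _; first by ring.
have w0 := slk_gt0 b b1; have wE := slk_sqr b b1; have sE := sgm_sqr.
have dE : dotv d b ^+ 2 = 1 - slk b ^+ 2 by lra.
have tE : dotv lam a ^+ 2 = 1 - sgm ^+ 2 by lra.
have -> : 1 - 2 * (dotv lam a + sgm * dotv d b / slk b) * dotv lam a +
  (dotv lam a + sgm * dotv d b / slk b) ^+ 2
  = 1 - dotv lam a ^+ 2 + sgm ^+ 2 * dotv d b ^+ 2 / slk b ^+ 2.
  by field; rewrite gt_eqF.
by rewrite dE tE; field; rewrite gt_eqF.
Qed.

Lemma optx_unit b : enorm b = 1 -> dotv (optx b) (optx b) = 1.
Proof.
move=> b1; have c0 := nmul_gt0 b b1; have cE := nmul_sqr b b1.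
rewrite !dotvE (dotvC a lam) aa ll.
apply: (mulfI (x := nmul b ^+ 2)); first by rewrite expf_neq0 // gt_eqF.
by rewrite [RHS]mulr1 [RHS]cE; field; rewrite gt_eqF.
Qed.

Lemma optx_tight b : enorm b = 1 -> 0 < dotv lam a + dotv d b ->
  dotv a (optx b) = - dotv d b.
Proof.
move=> b1 h; have w0 := slk_gt0 b b1; have s0 := sgm_gt0.
rewrite !dotvE aa (dotvC a lam) /nmul /hmul leNgt h /=.
by field; rewrite !gt_eqF.
Qed.

Lemma optx_slack b : dotv lam a + dotv d b <= 0 -> optx b = lam.
Proof.
by move=> h; rewrite /optx /nmul /hmul h invr1 scale1r scale0r subr0.
Qed.

Lemma optx_feas b : enorm b = 1 -> dotv a (optx b) + dotv d b <= 0.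
Proof.
move=> b1; have [h|h] := lerP (dotv lam a + dotv d b) 0.
  by rewrite optx_slack // (dotvC a).
by rewrite optx_tight // addNr.
Qed.

Lemma hmul_compl b : enorm b = 1 ->
  hmul b * (dotv a (optx b) + dotv d b) = 0.
Proof.
move=> b1; have [h|h] := lerP (dotv lam a + dotv d b) 0.
  by rewrite /hmul h mul0r.
by rewrite optx_tight // addNr mulr0.
Qed.

Lemma gradvE b y : dotv (gradv b) y = nmul b * dotv b y - hmul b * dotv d y.
Proof. by rewrite /gradv !dotvE. Qed.

(** Complementary slackness and [nmul_sqr] reduce [|gradv b|^2] to
    [1 - hmul b ^+ 2 * (1 - |d|^2)]. *)
Lemma enorm_gradv_le b : enorm b = 1 -> enorm (gradv b) <= 1.
Proof.
move=> b1; apply: enorm_le => //; rewrite expr1n.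
have dd : dotv d d <= 1.
  by rewrite dotvv; have := enorm_d_sqr; lra.
have cE := nmul_sqr b b1.
have hc := hmul_compl b b1.
have aopt : dotv a (optx b) * nmul b = dotv lam a - hmul b.
  rewrite /optx !dotvE aa (dotvC a lam); field.
  by rewrite gt_eqF // nmul_gt0.
have hc' : nmul b * hmul b * dotv d b = - (hmul b * (dotv lam a - hmul b)).
  rewrite -aopt.
  have -> : dotv d b = dotv a (optx b) + dotv d b - dotv a (optx b) by ring.
  by rewrite mulrBr -[X in X - _]mulrA hc; ring.
rewrite /gradv !dotvE (dotv_unit b b1) (dotvC b d).
have hd2 : hmul b ^+ 2 * dotv d d <= hmul b ^+ 2 * 1.
  by rewrite ler_wpM2l // sqr_ge0.
lra.
Qed.

(** For unit vectors this says that [optx] is nonexpansive. It drives both the subgradient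
    inequality for [phi] and the maximality argument. *)
Lemma optx_pair b b' : enorm b = 1 -> enorm b' = 1 ->
  dotv b b' <= dotv (optx b) (optx b').
Proof.
(* If the constraint at [c] holds at [lam], then [optx c = lam]. Comparing [gradv c' . c <= 1] with
   the decomposition of [lam.lam = 1] at [c'] gives the bound. *)
have mixed c c' : enorm c = 1 -> enorm c' = 1 ->
    dotv lam a + dotv d c <= 0 -> dotv c c' <= dotv lam (optx c').
  move=> c1 c'1 h; have k0 := nmul_gt0 c' c'1; have h0 := hmul_ge0 c' c'1.
  have := dotv_le (gradv c') c; rewrite c1 mulr1 => /le_trans.
  move=> /(_ _ (enorm_gradv_le c' c'1)) e2.
  rewrite /gradv !dotvE (dotvC c') in e2.
  have := dotv_lam_decomp c' lam c'1.
  rewrite ll (dotvC (optx c')) (dotvC a) => e1.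
  have e3 : hmul c' * (dotv lam a + dotv d c) <= 0 by rewrite mulr_ge0_le0.
  rewrite -(ler_pM2l k0); lra.
move=> b1 b'1; have [h|h] := lerP (dotv lam a + dotv d b) 0.
  by rewrite (optx_slack b h); apply: mixed.
have [h'|h'] := lerP (dotv lam a + dotv d b') 0.
  by rewrite (optx_slack b' h') dotvC (dotvC _ lam); apply: mixed.
have w0 := slk_gt0 b b1; have w'0 := slk_gt0 b' b'1; have s0 := sgm_gt0.
(* With both constraints tight, [optx b] has [a]-component [- d.b] and its part orthogonal to [a] is
   a vector of length [slk b] along [lam - (lam.a) a]. *)
have -> : dotv (optx b) (optx b') = slk b * slk b' + dotv d b * dotv d b'.
  rewrite /optx !dotvE aa ll (dotvC a) /nmul /hmul !leNgt h h' /=.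
  have tE : dotv lam a ^+ 2 = 1 - sgm ^+ 2 by rewrite sgm_sqr; ring.
  transitivity ((1 - dotv lam a ^+ 2) / sgm ^+ 2 * (slk b * slk b') +
      dotv d b * dotv d b').
    by field; rewrite !gt_eqF.
  by rewrite tE; field; rewrite !gt_eqF.
apply: (dotv_pair_le d) => //.
  by rewrite slk_sqr // dotv_unit.
by rewrite slk_sqr // (dotv_unit b').
Qed.

(** * Value and gradient of [phi], and the closed form of [rfun] *)

Local Notation phi := (phi a lam d).

Lemma phi_ge y x : enorm x <= enorm y -> dotv a x + dotv d y <= 0 ->
  dotv lam x <= phi y.
Proof.
move=> xy axy; apply: ub_le_sup; last by exists x.
exists (enorm y) => _ [z [zy _] <-].
exact: le_trans (dotv_unit_le lam z ll) zy.
Qed.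

Lemma phi_le_mult b y : enorm b = 1 ->
  phi y <= nmul b * enorm y - hmul b * dotv d y.
Proof.
move=> b1; apply: ge_sup.
  (* The supremum bound needs a feasible point: [- |y| a] is one because [|d| < 1]. *)
  exists (dotv lam (- enorm y *: a)), (- enorm y *: a) => //; split.
    by apply: enorm_le; rewrite ?enorm_ge0 // !dotvE aa; lra.
  rewrite dotvZr aa; have := dotv_le d y.
  have : 0 <= enorm y * (1 - enorm d).
    by rewrite mulr_ge0 ?enorm_ge0 // subr_ge0 ltW.
  lra.
move=> _ [x [xy axy] <-].
rewrite (dotv_lam_decomp b x b1).
have c0 := nmul_gt0 b b1.
have h0 := hmul_ge0 b b1.
have h1 := dotv_unit_le _ x (optx_unit b b1).
have : nmul b * dotv (optx b) x <= nmul b * enorm y.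
  by rewrite ler_pM2l // (le_trans h1).
have : hmul b * dotv a x <= hmul b * - dotv d y by rewrite ler_wpM2l //; lra.
lra.
Qed.

(** Bound [phi y] from below by a feasible point: [|y| lam] if the constraint allows it, where
    [|gradv b| <= 1] suffices, and otherwise [|y| optx (y / |y|)], where [optx_pair] applies. *)
Lemma gradv_le_phi b y : enorm b = 1 -> dotv (gradv b) y <= phi y.
Proof.
move=> b1; have [->|y0] := eqVneq y 0.
  rewrite dotv0r -(dotv0r lam); apply: phi_ge; rewrite ?enorm0 //.
  by rewrite !dotv0r addr0.
have yp : 0 < enorm y by apply: enorm_gt0; apply/eqP.
pose b' := (enorm y)^-1 *: y.
have b'1 : enorm b' = 1.
  by rewrite enormZ ?invr_ge0 ?enorm_ge0 // mulVf // gt_eqF.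
have yE : y = enorm y *: b' by rewrite scalerA mulfV ?scale1r ?gt_eqF.
clearbody b'.
have [h|h] := lerP (dotv lam a + dotv d b') 0.
  have : dotv lam (enorm y *: lam) <= phi y.
    apply: phi_ge; first by rewrite enormZ ?enorm_ge0 // hlam mulr1.
    rewrite {2}yE !dotvZr (dotvC a) -mulrDr.
    by rewrite mulr_ge0_le0 ?enorm_ge0.
  rewrite dotvZr ll mulr1; apply: le_trans.
  apply: le_trans (dotv_le _ _) _.
  by rewrite ler_piMl ?enorm_ge0 ?enorm_gradv_le.
have aopt := optx_tight b' b'1 h.
have : dotv lam (enorm y *: optx b') <= phi y.
  apply: phi_ge.
    rewrite enormZ ?enorm_ge0 //.
    rewrite (enorm_eq (optx b') 1) ?mulr1 // expr1n.
    exact: optx_unit.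
  rewrite (dotvZr _ a (optx b')) aopt {2}yE (dotvZr _ d b').
  by rewrite -mulrDr addNr mulr0.
apply: le_trans; rewrite gradvE {1 2}yE.
rewrite (dotvZr _ b b') (dotvZr _ d b') (dotvZr _ lam (optx b')).
rewrite (dotv_lam_decomp b (optx b') b1) aopt.
have c0 := nmul_gt0 b b1.
have := optx_pair b b' b1 b'1.
rewrite -(ler_pM2l c0) -(ler_pM2l yp); lra.
Qed.

(** Strong duality: the multiplier bound and the subgradient bound coincide at [y = b]. *)
Lemma phi_unit b : enorm b = 1 -> phi b = nmul b - hmul b * dotv d b.
Proof.
move=> b1; have bb := dotv_unit b b1.
apply/eqP; rewrite eq_le; apply/andP; split.
  by have := phi_le_mult b b b1; rewrite b1 mulr1.
by have := gradv_le_phi b b b1; rewrite gradvE bb mulr1.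
Qed.

(* [phi y - gradv b . y] lies between [0] and [nmul b * (|y| - b.y)]. *)
Lemma is_gradient_phi b : enorm b = 1 -> is_gradient phi b (gradv b).
Proof.
move=> b1 e e0.
have bb := dotv_unit b b1.
have c0 := nmul_gt0 b b1.
(* For [|h| < 1/2] the sum [|b + h| + 1 + b.h] is at least 1, so [|b + h| - (1 + b.h) <= |h|^2]. The
   second bound turns [nmul b * |h|^2] into at most [e |h|]. *)
exists (Num.min (1 / 2) (e / nmul b)); first by rewrite lt_min !divr_gt0.
move=> h; rewrite lt_min => /andP[h2 he].
have hge := enorm_ge0 h.
have lo := gradv_le_phi b (b + h) b1.
have up := phi_le_mult b (b + h) b1.
rewrite gradvE !dotvDr bb in lo; rewrite dotvDr in up.
rewrite (phi_unit b b1) gradvE.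
have bh := dotv_ge b h; rewrite b1 mul1r in bh.
have sq : (enorm (b + h) - (1 + dotv b h)) * (enorm (b + h) + (1 + dotv b h))
    <= enorm h ^+ 2.
  have -> : (enorm (b + h) - (1 + dotv b h)) * (enorm (b + h) + (1 + dotv b h))
    = enorm (b + h) ^+ 2 - (1 + dotv b h) ^+ 2 by ring.
  rewrite -!dotvv !dotvE bb (dotvC h b).
  have := sqr_ge0 (dotv b h); lra.
have yle : 1 + dotv b h <= enorm (b + h).
  by have := dotv_le b (b + h); rewrite dotvDr bb b1 mul1r.
have key : enorm (b + h) - (1 + dotv b h) <= enorm h ^+ 2.
  apply: le_trans sq; rewrite ler_peMr ?subr_ge0 //.
  lra.
have ce : nmul b * enorm h ^+ 2 <= e * enorm h.
  rewrite expr2 mulrA ler_wpM2r // mulrC -ler_pdivlMr //.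
  exact: ltW.
have ck : nmul b * (enorm (b + h) - (1 + dotv b h)) <= nmul b * enorm h ^+ 2.
  by rewrite ler_pM2l.
have eh : 0 <= e * enorm h by rewrite mulr_ge0 // ltW.
rewrite ler_norml; apply/andP; split; lra.
Qed.

Lemma rfunE b : enorm b = 1 -> rfun a lam d b = hmul b.
Proof.
move=> b1; rewrite /rfun phi_unit // /nmul /hmul.
case: (dotv lam a + dotv d b <= 0) => //.
have w0 := slk_gt0 b b1; have wE := slk_sqr b b1.
have s0 := sgm_gt0; have sE := sgm_sqr.
set w := slk b in w0 wE *; set s := sgm in s0 sE *.
set t := dotv lam a in sE *; set q := dotv d b in wE *.
(* This is the value [phi b]; adding [q * t] turns the denominator of [rfun] into [s * w]. *)
have den : s / w - (t + s * q / w) * q = s * w - t * q.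
  have -> : s / w - (t + s * q / w) * q = s * (1 - q ^+ 2) / w - t * q.
    by field; rewrite gt_eqF.
  by rewrite -wE; field; rewrite gt_eqF.
rewrite den; have -> : s * w - t * q + q * t = s * w by ring.
have -> : q + t * (s * w - t * q) = (1 - t ^+ 2) * q + t * s * w by ring.
by rewrite -sE; field; rewrite !gt_eqF.
Qed.

(** * Explicit inequalities for [Cset] *)

Lemma CsetE (p : 'rV[R]_n * 'rV[R]_m) : Cset a lam d p <->
  forall b, enorm b = 1 -> - dotv lam p.1 + dotv (gradv b) p.2 <= hmul b.
Proof.
split=> [Cp b b1|Cp b g b1 gb].
  by rewrite -rfunE //; apply: Cp => //; apply: is_gradient_phi.
(* Uniqueness of the gradient leaves one inequality for each [b]. *)
rewrite rfunE // (is_gradient_uniq _ _ _ _ gb (is_gradient_phi b b1)).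
exact: Cp.
Qed.

(* On [Hplane] the inequality indexed by [b] is homogeneous: it is [nmul b]
   times [b.y <= optx b . x]. *)
Lemma Cset_HplaneE (p : 'rV[R]_n * 'rV[R]_m) : Hplane a d p ->
  Cset a lam d p <-> forall b, enorm b = 1 -> dotv b p.2 <= dotv (optx b) p.1.
Proof.
rewrite CsetE /Hplane /= => Hp.
suff eqv b : enorm b = 1 ->
    (- dotv lam p.1 + dotv (gradv b) p.2 <= hmul b) =
    (dotv b p.2 <= dotv (optx b) p.1).
  by split=> h b b1; have := h b b1; rewrite eqv.
move=> b1; have c0 := nmul_gt0 b b1.
rewrite gradvE (dotv_lam_decomp b p.1 b1).
rewrite -[RHS](ler_pM2l c0).
have : hmul b * (dotv a p.1 + dotv d p.2) = - hmul b by rewrite Hp mulrN1.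
by move=> hH; apply/idP/idP; lra.
Qed.

(** * Slater points and relative interiors in the hyperplane *)

(** The bound is uniform in [b], so a single Slater point can serve all the inequalities. *)
Lemma nmul_le b : enorm b = 1 -> nmul b <= (1 - enorm d ^+ 2)^-1.
Proof.
move=> b1; have e0 := enorm_d_sqr; set e := 1 - _ in e0 *.
have e1 : e <= 1 by rewrite lerBlDr lerDl sqr_ge0.
have ie1 : 1 <= e^-1 by rewrite invf_ge1.
rewrite /nmul; case: ifP => // _.
have w0 := slk_gt0 b b1; have s0 := sgm_gt0.
have we : e <= slk b.
  have : e ^+ 2 <= slk b ^+ 2.
    rewrite expr2; apply: le_trans (ler_piMl (ltW e0) e1) _.
    by rewrite slk_sqr // /e; have := dotv_d_sqr b b1; lra.
  by rewrite ler_sqr ?nnegrE ?(ltW w0) ?(ltW e0).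
have s1 : sgm <= 1.
  have : sgm ^+ 2 <= 1 ^+ 2.
    by rewrite sgm_sqr; have := sqr_ge0 (dotv lam a); lra.
  by rewrite ler_sqr ?nnegrE ?(ltW s0).
rewrite ler_pdivrMr // mulrC ler_pdivlMr //.
apply: le_trans we; rewrite ler_piMl //; exact: ltW.
Qed.

Lemma dotv_orth : dotv a (lam - dotv lam a *: a) = 0.
Proof. by rewrite !dotvE aa (dotvC a); ring. Qed.

(** After scaling by [nmul b] the product is [1 - (lam.a)^2]. Moving against this direction stays in
    [Hplane] and decreases every [optx b . x]. *)
Lemma optx_orth_gt0 b : enorm b = 1 ->
  0 < dotv (optx b) (lam - dotv lam a *: a).
Proof.
move=> b1; have c0 := nmul_gt0 b b1; rewrite -(pmulr_rgt0 _ c0).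
have := dotv_lam_decomp b (lam - dotv lam a *: a) b1.
rewrite dotv_orth mulr0 addr0 => <-.
rewrite !dotvE ll; have := lam_a_sqr; lra.
Qed.

(** The slack 1 is twice the radius used in [slater_ball], since each side of an inequality changes
    by at most the distance moved. *)
Definition slater (p : 'rV[R]_n * 'rV[R]_m) : Prop := Hplane a d p /\
  forall b, enorm b = 1 -> dotv b p.2 + 1 <= dotv (optx b) p.1.

Lemma slater_ball p q : slater p -> Hplane a d q -> pdist p q < 1 / 2 ->
  Cset a lam d q.
Proof.
move=> [Hp sp] Hq pq; apply/Cset_HplaneE => // b b1.
have zn : enorm (optx b) <= 1 by apply: enorm_le; rewrite // expr1n optx_unit.
have := dotv_fst_pdist _ p q zn.
have := dotv_snd_pdist b p q; rewrite b1 => /(_ (lexx _)).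
rewrite !ler_norml => /andP[h1 h2] /andP[h3 h4].
have := sp b b1; lra.
Qed.

Lemma slater_exists : exists p, slater p.
Proof.
have e0 := enorm_d_sqr; set e := 1 - _ in e0.
have l0 := lam_a_sqr; set l := 1 - _ in l0.
pose u := lam - dotv lam a *: a.
(* [(-a, 0)] lies in [Hplane] and [u] is orthogonal to [a]. The coefficient makes
   [nmul b * optx b . x] equal to [2 / e - nmul b * optx b . a], hence at least [nmul b]. *)
exists ((2 * e^-1 / l) *: u - a, 0); split.
  by rewrite /Hplane /= dotv0r dotvDr dotvZr dotvNr dotv_orth aa; ring.
move=> b b1 /=; rewrite dotv0r add0r.
have c0 := nmul_gt0 b b1; have ce := nmul_le b b1.
have := dotv_lam_decomp b ((2 * e^-1 / l) *: u - a) b1.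
have := dotv_lam_decomp b a b1; rewrite aa.
have -> : dotv a ((2 * e^-1 / l) *: u - a) = - 1.
  by rewrite dotvDr dotvZr dotvNr dotv_orth aa; ring.
have -> : dotv lam ((2 * e^-1 / l) *: u - a) = 2 * e^-1 - dotv lam a.
  rewrite dotvDr dotvZr dotvNr.
  have -> : dotv lam u = l by rewrite /u !dotvE ll /l; ring.
  by field; rewrite !gt_eqF.
have := dotv_unit_le (optx b) a (optx_unit b b1); rewrite ha => h1.
have : nmul b * dotv (optx b) a <= nmul b * 1 by rewrite ler_pM2l.
rewrite -[1 <= _](ler_pM2l c0) -/e in ce *.
move=> *; lra.
Qed.

Lemma slater_translate p b t : enorm b = 1 -> 0 <= t ->
  dotv a (optx b) + dotv d b = 0 -> slater p ->
  slater (p.1 + t *: optx b, p.2 + t *: b).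
Proof.
move=> b1 t0 ab [Hp sp]; split.
  rewrite /Hplane /= !dotvDr (dotvZr t a (optx b)) (dotvZr t d b).
  rewrite addrACA -mulrDr ab mulr0 addr0; exact: Hp.
move=> b' b'1 /=; rewrite !dotvDr (dotvZr t _ (optx b)) (dotvZr t _ b).
have := sp b' b'1; have : t * dotv b' b <= t * dotv (optx b') (optx b).
  by rewrite ler_wpM2l // optx_pair.
lra.
Qed.

Lemma Hplane_mix t (p q : 'rV[R]_n * 'rV[R]_m) : Hplane a d p ->
  Hplane a d q ->
  Hplane a d (t *: p.1 + (1 - t) *: q.1, t *: p.2 + (1 - t) *: q.2).
Proof.
rewrite /Hplane /= !dotvE => Hp Hq.
transitivity (t * (dotv a p.1 + dotv d p.2) +
  (1 - t) * (dotv a q.1 + dotv d q.2)); first by ring.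
by rewrite Hp Hq; ring.
Qed.

(** The homothety of center [p] and ratio [t] sends the ball of radius 1/2 around [c] in [Hplane] to
    one of radius [t / 2], which convexity keeps in [C']. *)
Lemma slater_mix_relint (C' : set ('rV[R]_n * 'rV[R]_m)) c p t :
  convex_set C' -> Cset a lam d `<=` C' -> slater c -> C' p ->
  Hplane a d p -> 0 < t < 1 ->
  relint_in (Hplane a d) C'
    (t *: c.1 + (1 - t) *: p.1, t *: c.2 + (1 - t) *: p.2).
Proof.
move=> cvx sub sc C'p Hp /andP[t0 t1]; have Hc := sc.1.
have HM := Hplane_mix t _ _ Hc Hp.
have ball q : Hplane a d q ->
    pdist (t *: c.1 + (1 - t) *: p.1, t *: c.2 + (1 - t) *: p.2) q < t / 2 ->
    C' q.
  set z := (X in pdist X _) => Hq zq.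
  (* The preimage of [q] under the homothety. *)
  pose c' := (c.1 + t^-1 *: (q.1 - z.1), c.2 + t^-1 *: (q.2 - z.2)).
  have -> : q = (t *: c'.1 + (1 - t) *: p.1, t *: c'.2 + (1 - t) *: p.2).
    rewrite [q]surjective_pairing /c' /z /= !scalerDr !scalerA.
    rewrite mulfV ?gt_eqF // !scale1r.
    by congr pair; rewrite addrAC addrC subrK.
  apply: cvx => //; last by rewrite !ltW.
  apply: sub; apply: (slater_ball c) => //.
    have : t^-1 * (dotv a q.1 + dotv d q.2 - (dotv a z.1 + dotv d z.2)) = 0.
      by rewrite Hq HM subrr mulr0.
    move: Hc; rewrite /Hplane /c' /=.
    rewrite !(dotvDr _ c.1) !(dotvDr _ c.2) !(dotvZr t^-1).
    rewrite !(dotvDr _ q.1) !(dotvDr _ q.2) !dotvNr.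
    by move=> *; lra.
  rewrite (pdist_homothety t^-1 z q) ?invr_ge0 ?(ltW t0) //.
  - by rewrite mulrC ltr_pdivrMr //; lra.
  - by rewrite /c' /= opprD addNKr -scalerN opprB.
  - by rewrite /c' /= opprD addNKr -scalerN opprB.
split=> //; split; last by exists (t / 2) => //; rewrite divr_gt0.
apply: ball => //; rewrite /pdist !subrr !dotv0r addr0 sqrtr0.
by rewrite divr_gt0.
Qed.

(** * Closedness, convexity, freeness, maximality and interior points *)

Lemma Cset_closed : closed_set (Cset a lam d).
Proof.
move=> p cl; apply/CsetE => // b b1; rewrite leNgt; apply/negP => gap.
have e0 : 0 < (- dotv lam p.1 + dotv (gradv b) p.2 - hmul b) / 2.
  by rewrite divr_gt0 // subr_gt0.
have [q Cq pq] := cl _ e0.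
have := (CsetE q).1 Cq b b1.
have := dotv_fst_pdist lam p q; rewrite hlam => /(_ (lexx _)).
have := dotv_snd_pdist _ p q (enorm_gradv_le b b1).
rewrite !ler_norml => /andP[h1 h2] /andP[h3 h4] h5.
lra.
Qed.

Lemma Cset_convex : convex_set (Cset a lam d).
Proof.
move=> p q t Cp Cq /andP[t0 t1]; apply/CsetE => // b b1 /=.
have hp := (CsetE p).1 Cp b b1; have hq := (CsetE q).1 Cq b b1.
rewrite !(dotvDr _ (t *: _)) !(dotvZr t) !(dotvZr (1 - t)).
have : t * (- dotv lam p.1 + dotv (gradv b) p.2) <= t * hmul b.
  by rewrite ler_wpM2l.
have : (1 - t) * (- dotv lam q.1 + dotv (gradv b) q.2) <= (1 - t) * hmul b.
  by rewrite ler_wpM2l // subr_ge0.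
lra.
Qed.

Lemma Cset_free : S_free_wrt (Sle0 a d) (Hplane a d) (Cset a lam d).
Proof.
move=> [x y] [Hp [_ [e e0 ball]]] [[/= xy _] _].
have [y0|y0] := eqVneq y 0.
  have x0 : x = 0.
    apply: enorm_eq0; apply/eqP.
    by rewrite eq_le enorm_ge0 -(enorm0 (k:=m)) -y0 xy.
  by move: Hp; rewrite /Hplane /= x0 y0 !dotv0r; lra.
have yp : 0 < enorm y by apply: enorm_gt0; apply/eqP.
pose b := (enorm y)^-1 *: y.
have b1 : enorm b = 1.
  by rewrite enormZ ?invr_ge0 ?enorm_ge0 // mulVf // gt_eqF.
have by_ : dotv b y = enorm y.
  by rewrite dotvZl dotvv expr2 mulKf // gt_eqF.
pose u := lam - dotv lam a *: a.
have u0 := enorm_ge0 u.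
(* The move [- t u] has length below [e]; the added 1 gives a positive denominator and a strict
   bound. *)
pose t := e / (enorm u + 1).
have u1 : 0 < enorm u + 1 by lra.
have t0 : 0 < t by rewrite divr_gt0.
have Hq : Hplane a d (x - t *: u, y).
  rewrite /Hplane /= dotvDr dotvNr dotvZr dotv_orth mulr0 subr0; exact: Hp.
have pq : pdist (x, y) (x - t *: u, y) < e.
  rewrite /pdist /= subrr dotv0r addr0 opprB addrC subrK.
  rewrite -/(enorm _) enormZ ?(ltW t0) // /t mulrAC ltr_pdivrMr //.
  by rewrite ltr_pM2l //; lra.
have := (Cset_HplaneE _ Hq).1 (ball _ Hq pq) b b1.
rewrite /= by_ dotvDr dotvNr (dotvZr t _ u).
have : 0 < t * dotv (optx b) u by rewrite mulr_gt0 // optx_orth_gt0.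
have := dotv_unit_le (optx b) x (optx_unit b b1).
lra.
Qed.

(** On [Hplane] the linear condition of [Sle0] reads [-1 <= 0], so freeness only concerns the
    norms. *)
Lemma relint_normgap_lt0 (C' : set ('rV[R]_n * 'rV[R]_m)) p :
  S_free_wrt (Sle0 a d) (Hplane a d) C' -> relint_in (Hplane a d) C' p ->
  normgap p < 0.
Proof.
move=> free rp; rewrite ltNge; apply/negP => gap.
apply: (free p) => //; split; last exact: rp.1.
split; first exact: normgap_ge0.
by have := rp.1; rewrite /Hplane /= => ->; lra.
Qed.

(* A point [p] violating the inequality indexed by [b] is moved, within [C'],
   to a point with [|x| < |y|]: along the recession direction [(optx b, b)]
   when it is parallel to [Hplane], and towards the point of [Hplane] on the
   ray through [(optx b, b)] otherwise. *)
Lemma Cset_maximal (C' : set ('rV[R]_n * 'rV[R]_m)) :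
  convex_set C' -> Cset a lam d `<=` C' ->
  S_free_wrt (Sle0 a d) (Hplane a d) C' ->
  C' `&` Hplane a d `<=` Cset a lam d `&` Hplane a d.
Proof.
move=> cvx sub free p [C'p Hp]; split => //.
apply/Cset_HplaneE => // b b1; rewrite leNgt; apply/negP => viol.
have [c sc] := slater_exists.
have bb := dotv_unit b b1.
have zz := optx_unit b b1; have := optx_feas b b1; rewrite le_eqVlt.
set z := optx b in viol zz *; set g := dotv b p.2 - dotv z p.1.
have g0 : 0 < g by rewrite subr_gt0.
case/orP => [/eqP par|neg].
  (* Translation by [M] adds [2 M g = 2 (|normgap p| + 1)] to the gap, which makes it positive. *)
  pose M := (`|normgap p| + 1) / g.
  have M0 : 0 <= M by apply: divr_ge0; [apply: addr_ge0|apply: ltW].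
  have gapM : 0 < normgap (p.1 + M *: z, p.2 + M *: b).
    rewrite normgap_translate ?zz // -/g mulfVK ?gt_eqF //.
    have := lerNnormlW (lexx `|normgap p|); have := normr_ge0 (normgap p); lra.
  have [t t01] := normgap_mix _ c gapM; rewrite leNgt => /negP; apply.
  have /andP[t0 t1] := t01.
  (* Since [t K = (1 - t) M], translating [c] by [K] gives the same mixture as translating [p] by
     [M]; thus the translate of [p] need not be shown to lie in [C']. *)
  pose K := (1 - t) * M / t.
  have K0 : 0 <= K.
    apply: divr_ge0; last exact: ltW.
    by apply: mulr_ge0; rewrite // subr_ge0 ltW.
  have := slater_mix_relint C' _ p t cvx sub
    (slater_translate c b K b1 K0 par sc) C'p Hp t01.
  move=> /(relint_normgap_lt0 _ _ free); congr (normgap _ < 0).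
  have KE : t * K = (1 - t) * M by rewrite mulrC mulfVK // gt_eqF.
  by rewrite /= !scalerDr !scalerA KE -!addrA;
    congr (_ + _, _ + _); rewrite addrC.
set k := - (dotv a z + dotv d b).
have k0 : 0 < k by rewrite oppr_gt0.
pose q := (k^-1 *: z, k^-1 *: b).
have Hq : Hplane a d q.
  rewrite /Hplane /= (dotvZr _ a z) (dotvZr _ d b) -mulrDr.
  by rewrite -[X in _ * X]opprK -/k mulrN mulVf // gt_eqF.
have Cq : Cset a lam d q.
  apply/Cset_HplaneE => // b' b'1 /=.
  rewrite (dotvZr _ _ z) (dotvZr _ b' b) ler_pM2l ?invr_gt0 //.
  exact: optx_pair.
have g'0 : 0 < k^-1 * g by rewrite mulr_gt0 // invr_gt0.
(* [q] has zero gap, so near [q] the sign is that of the cross term, a positive multiple of [g]. *)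
have [u u01 gapu] : exists2 u, 0 < u < 1 &
    0 < normgap (u *: p.1 + (1 - u) *: q.1, u *: p.2 + (1 - u) *: q.2).
  have [u /andP[u0 u1] uE] :=
    linear_gt0_near0 _ (normgap p) (mulr_gt0 (ltr0Sn R 1) g'0).
  exists u; first by rewrite u0.
  by rewrite normgap_mix_null ?zz // mulr_gt0.
have [t t01] := normgap_mix _ c gapu; rewrite leNgt => /negP; apply.
apply: (relint_normgap_lt0 _ _ free).
apply: (slater_mix_relint C' _ _ t) => //; last exact: Hplane_mix.
apply: cvx => //; first exact: sub.
by case/andP: u01 => u0 u1; rewrite !ltW.
Qed.

(** At the point, [lam.x = |x|] and [|gradv b| <= 1] bound every left-hand side by
    [|y| - |x| < 0 <= hmul b]. Two linear terms vary, hence half of the gap as radius. *)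
Lemma Cset_interior xb yb : enorm yb < enorm xb ->
  lam = (enorm xb)^-1 *: xb -> interior_pt (Cset a lam d) (xb, yb).
Proof.
move=> lt_yx lamE.
have x0 : 0 < enorm xb by apply: le_lt_trans lt_yx; apply: enorm_ge0.
have lx : dotv lam xb = enorm xb.
  by rewrite lamE dotvZl dotvv expr2 mulKf // gt_eqF.
exists ((enorm xb - enorm yb) / 2); first by rewrite divr_gt0 // subr_gt0.
move=> q pq; apply/CsetE => // b b1.
have := hmul_ge0 b b1; have gn := enorm_gradv_le b b1.
have := dotv_fst_pdist lam (xb, yb) q; rewrite hlam => /(_ (lexx _)).
have := dotv_snd_pdist _ (xb, yb) q gn.
rewrite !ler_norml /= lx => /andP[h1 h2] /andP[h3 h4] h5.
have := dotv_le (gradv b) yb.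
have : enorm (gradv b) * enorm yb <= enorm yb by rewrite ler_piMl ?enorm_ge0.
lra.
Qed.

End Multipliers.

Theorem theorem10 (R : realType) (n m : nat) (hn : (1 <= n)%N) (hm : (1 <= m)%N)
  (a lam : 'rV[R]_n) (d : 'rV[R]_m)
  (ha : enorm a = 1) (hd : enorm d < 1) (hlam : enorm lam = 1)
  (hla : lam <> a) (hlma : lam <> - a) :
  maximal_S_free_wrt (Sle0 a d) (Hplane a d) (Cset a lam d) /\
  (forall (xb : 'rV[R]_n) (yb : 'rV[R]_m),
     Hplane a d (xb, yb) -> enorm yb < enorm xb ->
     lam = (enorm xb)^-1 *: xb ->
     interior_pt (Cset a lam d) (xb, yb)).
Proof.
split; last by move=> xb yb _; apply: Cset_interior.
split; first exact: Cset_closed.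
split; first exact: Cset_convex.
split; first exact: Cset_free.
by move=> C' _; apply: Cset_maximal.
Qed.
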